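(* For all $y\in B$, $$P_y(\tau<\infty)=\sum_{d=1}^{D}\left(\prod_{l=d+1}^{D}\frac{\mu_l-\lambda}{\mu_l-\mu_d}\right)h_d^*(y).$$
   Context: Let $D\ge2$ and let $\lambda,\mu_1,\dots,\mu_D>0$ with $\lambda+\sum_j\mu_j=1$, $\lambda<\mu_j$ for all $j$, and $\mu_i\ne\mu_j$ for $i\ne j$. Put $\rho_j=\lambda/\mu_j$ and $\mathcal N=\{2,\dots,D\}$. $Y$ (arising from $D$ queues in tandem) is the Markov chain on $\mathbb{Z}\times\mathbb{Z}_+^{D-1}$ with i.i.d. increments equal to $-e_1$ with probability $\lambda$, $e_1+e_2$ with probability $\mu_1$, $-e_j+e_{j+1}$ with probability $\mu_j$ for $2\le j\le D-1$, and $-e_D$ with probability $\mu_D$, where an increment is replaced by $0$ whenever it would take $Y$ out of $\mathbb{Z}\times\mathbb{Z}_+^{D-1}$. $P_y$ is the probability when $Y_0=y$. $B=\{y\in\mathbb{Z}\times\mathbb{Z}_+^{D-1}:y(1)\ge\sum_{j=2}^Dy(j)\}$ and $\tau=\inf\{k:Y_k(1)=\sum_{j=2}^DY_k(j)\}$. For a nonempty $a\subset\{1,\dots,D\}$ with elements $a(1)<\dots<a(|a|)$, define $$\boldsymbol c_a^*=(-1)^{|a|-1}\prod_{j=1}^{|a|-1}\ \prod_{l=a(j)+1}^{a(j+1)}\frac{\mu_l-\lambda}{\mu_l-\mu_{a(j)}},$$ and for $l\in\mathcal N$: $\alpha_a^*(l)=1$ if $l\le a(1)$; $\alpha_a^*(l)=\rho_{a(j)}$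 if $a(j)<l\le a(j+1)$; $\alpha_a^*(l)=\rho_{a(|a|)}$ if $l>a(|a|)$. For $z\in\mathbb{Z}^D$, $[(\beta,\alpha),z]=\beta^{z(1)-\sum_{j\in\mathcal N}z(j)}\prod_{j\in\mathcal N}\alpha(j)^{z(j)}$. For $d=1,\dots,D$, $$h_d^*=\sum_{a\subset\{1,\dots,d-1\}}\boldsymbol c^*_{a\cup\{d\}}\,[(\rho_d,\alpha^*_{a\cup\{d\}}),\cdot].$$ Empty products equal $1$. *)

(* Defs.v *)
From HB Require Import structures.
From mathcomp Require Export all_boot all_order all_algebra.
From mathcomp Require Export all_classical all_reals all_analysis.

Set Implicit Arguments.
Unset Strict Implicit.
Unset Printing Implicit Defensive.
Import Order.TTheory GRing.Theory Num.Theory.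

Local Open Scope classical_set_scope.
Local Open Scope ring_scope.

(* The number of queues is D = n.+2, i.e. D >= 2. The index set {1, ..., D}   *)
(* is 'I_n.+2 shifted by one: the queue j is the ordinal of value j - 1. In   *)
(* particular the coordinate 1 is ord0, the coordinate D is ord_max, and      *)
(* {2, ..., D} is the set of j != ord0.                                       *)

Section Chain.
Variable n : nat.
Implicit Types (y v z : 'rV[int]_n.+2) (j : 'I_n.+2).

Definition ebase j : 'rV[int]_n.+2 := delta_mx 0 j.

Definition arrival : 'rV[int]_n.+2 := - ebase ord0.

(* e_1 + e_2, then - e_j + e_{j+1}, and - e_D for the last queue *)
Definition service j : 'rV[int]_n.+2 :=
  (if j == ord0 then ebase j else - ebase j) +
  (if j == ord_max then 0 else ebase (inord j.+1)).

(* Z x Z_+^{D-1} *)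
Definition state_space y : bool := [forall j, (j != ord0) ==> (0 <= y 0 j)].

Definition tail_sum y : int := \sum_(j | j != ord0) y 0 j.

Definition B : set 'rV[int]_n.+2 :=
  [set y | state_space y /\ tail_sum y <= y 0 ord0].

Definition step y v : 'rV[int]_n.+2 :=
  if state_space (y + v) then y + v else y.

Fixpoint chain (T : Type) (I : nat -> T -> 'rV[int]_n.+2) y (k : nat) (w : T) :
    'rV[int]_n.+2 :=
  if k is k'.+1 then step (chain I y k' w) (I k' w) else y.

(* inf {k : Y_k(1) = Y_k(2) + ... + Y_k(D)}, equal to +oo if there is no k *)
Definition tau (R : realType) (T : Type) (Y : nat -> T -> 'rV[int]_n.+2) (w : T) :
    \bar R :=
  ereal_inf [set k%:R%:E | k in [set k | Y k w 0 ord0 = tail_sum (Y k w)]].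

End Chain.

(* The countable type S carries the discrete sigma-algebra. *)
Definition discrete_measurable_fun d (T : measurableType d) (S : Type)
    (X : T -> S) : Prop :=
  forall A : set S, measurable (X @^-1` A).

Definition mutually_independent d (T : measurableType d) (R : realType)
    (P : probability T R) (S : Type) (X : nat -> T -> S) : Prop :=
  forall (J : seq nat) (A : nat -> set S), uniq J ->
    P (\bigcap_(k in [set` J]) (X k @^-1` A k)) =
    (\prod_(k <- J) P (X k @^-1` A k))%E.

(* The vectors arrival and service j (j = 1, ..., D) are pairwise distinct and *)
(* lam + mu_1 + ... + mu_D = 1, so the last two items fix the law of I k.      *)
Definition iid_increments (n : nat) d (T : measurableType d) (R : realType)
    (P : probability T R) (lam : R) (mu : 'I_n.+2 -> R)
    (I : nat -> T -> 'rV[int]_n.+2) : Prop :=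
  [/\ forall k, discrete_measurable_fun (I k),
      mutually_independent P I,
      forall k, P (I k @^-1` [set arrival n]) = lam%:E
    & forall k j, P (I k @^-1` [set service j]) = (mu j)%:E].

Section Harmonic.
Variables (R : realType) (n : nat) (lam : R) (mu : 'I_n.+2 -> R).
Implicit Types (a : {set 'I_n.+2}) (l d : 'I_n.+2) (z : 'rV[int]_n.+2).

Definition rho l : R := lam / mu l.

(* enum a lists a increasingly, so a(j) = elt a (j - 1) for 1 <= j <= #|a| *)
Definition elt a (j : nat) : 'I_n.+2 := nth ord0 (enum a) j.

Definition c_star a : R :=
  (-1) ^+ #|a|.-1 *
  \prod_(j < #|a|.-1)
    \prod_(l : 'I_n.+2 | (elt a j < l <= elt a j.+1)%N)
      ((mu l - lam) / (mu l - mu (elt a j))).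

(* On a nonempty set a the default 1 of the last branch is never reached. *)
Definition alpha_star a l : R :=
  if (l <= elt a 0)%N then 1
  else if (elt a #|a|.-1 < l)%N then rho (elt a #|a|.-1)
  else if [pick j : 'I_(#|a|.-1) | (elt a j < l <= elt a j.+1)%N] is Some j
       then rho (elt a j)
  else 1.

Definition bracket (beta : R) (alpha : 'I_n.+2 -> R) z : R :=
  beta ^ (z 0 ord0 - tail_sum z) * \prod_(j | j != ord0) alpha j ^ z 0 j.

Definition h_star d z : R :=
  \sum_(a : {set 'I_n.+2} | a \subset [set i : 'I_n.+2 | (i < d)%N]%SET)
    c_star (d |: a)%SET * bracket (rho d) (alpha_star (d |: a)%SET) z.

End Harmonic.

(* Main.v *)
Require Import Defs.
From mathcomp Require Import ring zify.
Set Implicit Arguments.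
Unset Strict Implicit.
Unset Printing Implicit Defensive.
Import Order.TTheory GRing.Theory Num.Theory.
Import numFieldNormedType.Exports.
Local Open Scope classical_set_scope.
Local Open Scope ring_scope.

(** Write z = y(1) - (y(2) + ... + y(D)) for the gap of a state y; tau is the
    first time at which the gap is 0.  Along the chain the gap drops by 1 at an
    arrival, grows by 1 at a service of queue D, and is unchanged otherwise.

    The claimed sum u is best understood through 1 - u.  Put mu_0 = lam and
    rho_0 = 1.  Each nonempty set a of queues with maximum d contributes to u a
    product over the queues l, in which l enters through the largest element i
    of a below l (i = 0 if there is none): the factor is
      (mu_l - lam) / (mu_l - mu_i) * rho_i ^ y(l),
    equal to 1 if i = 0, times rho_d ^ z and the sign (-1)^(#|a| - 1).  Hence
    1 - u is a sum over all subsets a, and deciding queue by queue whether l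
    belongs to a turns it into the recursion
      F_(D+1)(i) = rho_i ^ z,
      F_l(i) = (mu_l - lam) / (mu_l - mu_i) * rho_i ^ y(l)
                 * (F_(l+1)(i) - F_(l+1)(l)),
    with 1 - u = F_1(0).  This is the function escape below, and sum_h_star is
    this identity.

    From the recursion one reads off the three facts that characterize u.
    - If z = 0, then all F_(D+1)(i) are 1, so the differences vanish and u = 1.
    - F_l(i) is an eigenfunction, with eigenvalue mu_i - lam, of the drift of
      the arrivals and of the services at the queues >= l, up to a correction
      at y(l) = 0 that does not depend on i (drift_escape).  The correction
      therefore cancels in the next difference, and u is harmonic on B,
      including the states where some queues are empty (mean_no_hit).
    - u is bounded by C * r ^ z for some r < 1 (hit_bound).

    Let p_k(y) = P_y(tau <= k).  From a state with gap at most M the walk reaches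
    gap 0 by M consecutive arrivals, which has probability lam ^ M.  So the
    probability of being, at time k, still unstopped and at gap at most M is at
    most lam ^ (- M) * (p_(k+M) - p_k), which tends to 0 as k grows.  The states
    of gap larger than M contribute at most C * r ^ M to the difference u - p_k,
    those of smaller gap at most C times the probability just estimated.
    Hence p_k tends to u (cvg_hit_prob), while p_k(y) also tends to
    P_y(tau < +oo) by continuity from below (probability_tau). *)

(** * The gap and the increments *)

Section Queues.
Variable n : nat.
Implicit Types (y v : 'rV[int]_n.+2) (j l : 'I_n.+2).

Definition gap y : int := y 0 ord0 - tail_sum y.

(** The index is a natural number, so that the suffix after the last queue is
    the empty list. *)
Definition queues_from (l : nat) : seq 'I_n.+2 := drop l (enum 'I_n.+2).

Lemma queues_fromE j : queues_from j = j :: queues_from j.+1.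
Proof.
rewrite /queues_from (drop_nth ord0) ?size_enum_ord//.
by rewrite nth_ord_enum.
Qed.

Lemma queues_from_nil (l : nat) : (n.+2 <= l)%N -> queues_from l = [::].
Proof. by move=> h; apply: drop_oversize; rewrite size_enum_ord. Qed.

Lemma mem_queues_from (l : nat) j : (j \in queues_from l) = (l <= j)%N.
Proof.
have [k] := ubnP (n.+2 - l); elim: k l => // k IH l hl.
have [h|h] := leqP n.+2 l.
  by rewrite queues_from_nil// in_nil leqNgt (leq_trans (ltn_ord j) h).
rewrite (queues_fromE (Ordinal h)) in_cons IH /=; last first.
  by rewrite subnS prednK ?subn_gt0.
by rewrite [RHS]leq_eqVlt eq_sym.
Qed.

Lemma queues_from_ind (Q : seq 'I_n.+2 -> Prop) : Q [::] ->
  (forall j, Q (queues_from j.+1) -> Q (j :: queues_from j.+1)) ->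
  forall l : nat, Q (queues_from l).
Proof.
move=> Q0 QS l; have [k] := ubnP (n.+2 - l); elim: k l => // k IH l hl.
have [h|h] := leqP n.+2 l; first by rewrite queues_from_nil.
rewrite (queues_fromE (Ordinal h)); apply: QS; apply: (IH l.+1).
by rewrite subnS prednK ?subn_gt0.
Qed.

Lemma ebaseE j l : ebase j 0 l = (l == j)%:R.
Proof. by rewrite mxE eqxx. Qed.

Lemma tail_sumD y v : tail_sum (y + v) = tail_sum y + tail_sum v.
Proof. by rewrite -big_split; apply: eq_bigr => j _; rewrite mxE. Qed.

Lemma tail_sumN y : tail_sum (- y) = - tail_sum y.
Proof. by rewrite -sumrN; apply: eq_bigr => j _; rewrite mxE. Qed.

Lemma gapD y v : gap (y + v) = gap y + gap v.
Proof. by rewrite /gap tail_sumD mxE; ring. Qed.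

Lemma gapN y : gap (- y) = - gap y.
Proof. by rewrite /gap tail_sumN mxE; ring. Qed.

Lemma gap_ebase j : gap (ebase j) = if j == ord0 then 1 else -1.
Proof.
rewrite /gap /tail_sum ebaseE [ord0 == j]eq_sym; case: ifPn => [/eqP->|j0].
  by rewrite big1 ?subr0// => i /negPf h; rewrite ebaseE h.
rewrite (bigD1 j)//= ebaseE eqxx big1 ?addr0 ?sub0r// => i /andP[_ /negPf h].
by rewrite ebaseE h.
Qed.

Lemma gap_arrival : gap (arrival n) = -1.
Proof. by rewrite gapN gap_ebase eqxx. Qed.

Lemma gap_service j : gap (service j) = (j == ord_max)%:R.
Proof.
rewrite /service gapD; have [->|jm] := eqVneq j ord_max.
  rewrite /= gapN gap_ebase /= /gap /tail_sum big1 => [|i _]; rewrite mxE//.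
have jn : (j.+1 < n.+2)%N by rewrite ltn_neqAle jm ltn_ord.
have S0 : (inord j.+1 == ord0 :> 'I_n.+2) = false by rewrite -val_eqE/= inordK.
rewrite (gap_ebase (inord _)) S0.
by case: ifP => [/eqP->|h]; rewrite ?gapN gap_ebase ?h ?opprK ?eqxx subrr.
Qed.

Lemma serviceE j l : service j 0 l =
  (if j == ord0 then (l == j)%:R else - (l == j)%:R) + (l == j.+1 :> nat)%:R.
Proof.
rewrite /service mxE; congr (_ + _).
  by case: ifP => _; [rewrite ebaseE | rewrite mxE ebaseE].
have [->|jm] := eqVneq j ord_max.
  by rewrite mxE /= [l == n.+2 :> nat]ltn_eqF.
have jn : (j.+1 < n.+2)%N by rewrite ltn_neqAle jm ltn_ord.
by rewrite ebaseE -val_eqE/= inordK.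
Qed.

Lemma arrivalE l : arrival n 0 l = - (l == ord0)%:R.
Proof. by rewrite mxE ebaseE. Qed.

Lemma step_arrival y : state_space y -> step y (arrival n) = y + arrival n.
Proof.
move=> /forallP yS; rewrite /step ifT//; apply/forallP => j; apply/implyP => j0.
by rewrite mxE arrivalE (negPf j0) subr0; apply: (implyP (yS j)).
Qed.

Lemma step_service y j : state_space y ->
  step y (service j) =
  if (j == ord0) || (0 < y 0 j) then y + service j else y.
Proof.
move=> /forallP yS; rewrite /step; congr (if _ then _ else _).
apply/forallP/idP => [/(_ j)|h i].
  case: (eqVneq j ord0) => //= j0; rewrite mxE serviceE eqxx (negPf j0).
  by rewrite [j == j.+1 :> nat]ltn_eqF// addr0 mulr1n subr_ge0 gtz0_ge1.
apply/implyP => i0; have := implyP (yS i) i0; rewrite mxE serviceE.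
case: (eqVneq j ord0) h => /= [->|j0].
  by rewrite (negPf i0) add0r => _ h; rewrite addr_ge0.
case: (eqVneq i j) => [->|ij] h h1.
  by rewrite ltn_eqF// mulr1n addr0 subr_ge0 -gtz0_ge1.
by rewrite oppr0 add0r addr_ge0.
Qed.

End Queues.

Arguments queues_from {n} l.

(** * The escape function and its drift *)

Section Escape.
Variables (R : realType) (n : nat) (lam : R) (mu : 'I_n.+2 -> R).
Implicit Types (y v : 'rV[int]_n.+2) (j : 'I_n.+2) (s : seq 'I_n.+2).
Implicit Types (f : 'rV[int]_n.+2 -> R) (m : R).

Definition factor m j y : R :=
  (mu j - lam) / (mu j - m) * (lam / m) ^ y 0 j.

(** The function F_l(i), with s the list of the queues from l on and m = mu_i.
    For m = lam and the list of all queues it turns out to be, on B, the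
    probability of never reaching gap 0. *)
Fixpoint escape m s y : R :=
  if s is j :: s' then factor m j y * (escape m s' y - escape (mu j) s' y)
  else (lam / m) ^ gap y.

(** The generator of the walk in which only the arrivals and the services at
    the queues of s are kept. *)
Definition drift s f y : R :=
  lam * (f (y + arrival n) - f y)
  + \sum_(j <- s | 0 < y 0 j) mu j * (f (y + service j) - f y).

(** The defect of the eigenfunction equation when the first queue of s is empty.
    The point of its form is that it does not involve the parameter m of
    escape. *)
Definition boundary_term s y : R :=
  if s is j :: s' then
    if y 0 j == 0 then (mu j - lam) * escape (mu j) s' y else 0
  else 0.

Lemma escape_ext m s y y' : {in s, forall j, y' 0 j = y 0 j} ->
  gap y' = gap y -> escape m s y' = escape m s y.
Proof.
move=> + eg; elim: s m => [|j s IH] m /= es; first by rewrite eg.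
rewrite /factor es ?mem_head// !IH// => i si; apply: es; exact: mem_behead.
Qed.

Lemma escape_gap0 m s y : gap y = 0 -> s != [::] -> escape m s y = 0.
Proof.
move=> g0; elim: s m => // j [|k s] IH m _ /=.
  by rewrite g0 !expr0z subrr mulr0.
by rewrite -!/(escape _ (k :: s) y) !IH// subrr mulr0.
Qed.

Hypothesis lam_gt0 : 0 < lam.

(** A service at queue j adds a customer to the next queue, or adds 1 to the gap
    if j is the last queue; both multiply the recursion by lam / m. *)
Lemma escape_service m j y : m != 0 ->
  escape m (queues_from j.+1) (y + service j) =
  lam / m * escape m (queues_from j.+1) y.
Proof.
move=> m0; have rho0 : lam / m != 0.
  by rewrite mulf_neq0 ?invr_neq0 ?(lt0r_neq0 lam_gt0).
have [->|jm] := eqVneq j ord_max.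
  by rewrite queues_from_nil//= gapD gap_service eqxx expfzDr// mulr1n expr1z mulrC.
have jn : (j.+1 < n.+2)%N by rewrite ltn_neqAle jm ltn_ord.
rewrite (queues_fromE (Ordinal jn)).
have ext m' : escape m' (queues_from j.+2) (y + service j) =
    escape m' (queues_from j.+2) y.
  apply: escape_ext => [i|].
    rewrite mem_queues_from mxE serviceE => ji.
    rewrite (gtn_eqF ji) -[i == j]val_eqE/= (gtn_eqF (ltnW ji)).
    by case: ifP => _; rewrite ?oppr0 !addr0.
  by rewrite gapD gap_service (negPf jm) addr0.
rewrite /= !ext /factor mxE serviceE eqxx -[Ordinal jn == j]val_eqE/= gtn_eqF//.
have -> : (if j == ord0 then 0%:R else - 0%:R) + 1%:R = 1 :> int.
  by case: ifP => _; rewrite ?oppr0 add0r.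
rewrite expfzDr// expr1z; ring.
Qed.

Lemma driftB s f g y : drift s (fun z => f z - g z) y = drift s f y - drift s g y.
Proof.
rewrite /drift.
rewrite (eq_bigr (fun j => mu j * (f (y + service j) - f y)
                           - mu j * (g (y + service j) - g y))) => [|j _]; last ring.
by rewrite sumrB; ring.
Qed.

Lemma driftZ s c f y : drift s (fun z => c * f z) y = c * drift s f y.
Proof.
rewrite /drift [RHS]mulrDr mulr_sumr; congr (_ + _); first ring.
by apply: eq_bigr => j _; ring.
Qed.

Lemma eq_drift s f g y : f y = g y ->
  f (y + arrival n) = g (y + arrival n) ->
  {in s, forall j, f (y + service j) = g (y + service j)} ->
  drift s f y = drift s g y.
Proof.
move=> e0 e1 es; rewrite /drift e0 e1; congr (_ + _).
by rewrite big_seq_cond [RHS]big_seq_cond; apply: eq_bigr => j /andP[/es->].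
Qed.

Lemma drift_cons j s f y : drift (j :: s) f y =
  (if 0 < y 0 j then mu j * (f (y + service j) - f y) else 0) + drift s f y.
Proof. by rewrite /drift big_cons; case: ifP => _; rewrite ?add0r// addrCA. Qed.

Hypothesis stable : forall j, lam < mu j.
Hypothesis mu_distinct : forall i j : 'I_n.+2, i != j -> mu i != mu j.

Lemma mu_neq0 j : mu j != 0.
Proof. by rewrite gt_eqF// (lt_trans lam_gt0). Qed.

(** By induction on the list of queues j :: s.  In the difference
    escape m s - escape (mu j) s the boundary terms of s cancel, and a service
    at j supplies exactly the amount needed to replace the eigenvalue
    mu j - lam of the second term by m - lam.  If queue j is empty, this service
    is missing and leaves the boundary term. *)
Lemma drift_escape (l : nat) m y : (0 < l)%N -> m != 0 ->
  (forall j, (l <= j)%N -> mu j != m) ->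
  (forall j, (l <= j)%N -> 0 <= y 0 j) ->
  drift (queues_from l) (escape m (queues_from l)) y =
  (m - lam) * escape m (queues_from l) y - boundary_term (queues_from l) y.
Proof.
move=> l0 m0 mum yge0.
have : {in queues_from l, forall j : 'I_n.+2,
    [/\ j != ord0, mu j != m & 0 <= y 0 j]}.
  move=> j; rewrite mem_queues_from => lj; split; [|exact: mum|exact: yge0].
  by rewrite -val_eqE -lt0n; apply: leq_trans lj.
move: m m0 {l0 mum yge0}; move: l; apply: (queues_from_ind (Q := fun s =>
  forall m, m != 0 ->
    {in s, forall j, [/\ j != ord0, mu j != m & 0 <= y 0 j]} ->
    drift s (escape m s) y = (m - lam) * escape m s y - boundary_term s y))
  => [|j IH] m m0 hs.
  rewrite /drift big_nil /= gapD gap_arrival expfzDr; last first.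
    by rewrite mulf_neq0 ?invr_neq0 ?(lt0r_neq0 lam_gt0).
  by rewrite exprN1; field; rewrite m0 lt0r_neq0.
have [j0 mujm yj] := hs j (mem_head _ _).
have hs' : {in queues_from j.+1, forall i : 'I_n.+2,
    [/\ i != ord0, mu i != m & 0 <= y 0 i]}.
  by move=> i si; apply: hs; rewrite in_cons si orbT.
have hsj : {in queues_from j.+1, forall i : 'I_n.+2,
    [/\ i != ord0, mu i != mu j & 0 <= y 0 i]}.
  move=> i si; have [i0 _ yi] := hs' i si; split=> //; apply: mu_distinct.
  by move: si; rewrite mem_queues_from -val_eqE => /gtn_eqF->.
rewrite drift_cons (eq_drift (g := fun z => factor m j y *
  (escape m (queues_from j.+1) z - escape (mu j) (queues_from j.+1) z)))//=.
- rewrite driftZ driftB (IH _ m0 hs') (IH _ (mu_neq0 j) hsj).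
  rewrite /escape-/escape !(escape_service _ _ m0, escape_service _ _ (mu_neq0 j)).
  have mj : mu j - m != 0 by rewrite subr_eq0.
  have muj0 := mu_neq0 j; have l0 := lt0r_neq0 lam_gt0.
  have [yj0|yj0] := eqVneq (y 0 j) 0.
    by rewrite /factor yj0 ltxx expr0z; field.
  rewrite lt0r yj0 yj /= /factor mxE serviceE eqxx (negPf j0) ltn_eqF//.
  rewrite addr0 mulr1n expfzDr ?mulf_neq0 ?invr_neq0// exprN1.
  by field; rewrite mj muj0 m0.
- by rewrite /factor mxE arrivalE (negPf j0) subr0.
- move=> i; rewrite mem_queues_from => ji; rewrite /factor mxE serviceE.
  rewrite -[j == i]val_eqE/= (ltn_eqF ji) (ltn_eqF (leqW ji)).
  by case: ifP => _; rewrite ?oppr0 !addr0.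
Qed.
End Escape.

(** * The one-step mean and the probability of hitting before a given time *)

Section StateSpace.
Variable n : nat.
Implicit Types (y v : 'rV[int]_n.+2).

Lemma step_state_space y v : state_space y -> state_space (step y v).
Proof. by rewrite /step; case: ifP. Qed.

Lemma B_gap y : B y -> 0 <= gap y.
Proof. by case=> _; rewrite subr_ge0. Qed.

Lemma B_coord_ge0 y : B y -> forall j, 0 <= y 0 j.
Proof.
case=> /forallP yS yB j; case: (eqVneq j ord0) => [->|j0].
  apply: le_trans yB; apply: sumr_ge0 => i i0; exact: (implyP (yS i)).
exact: (implyP (yS j)).
Qed.

Definition jump (a : option 'I_n.+2) : 'rV[int]_n.+2 :=
  if a is Some j then service j else arrival n.

Lemma gap_jump_ge a : -1 <= gap (jump a).
Proof. by case: a => [j|] /=; rewrite ?gap_service ?gap_arrival//; case: eqP. Qed.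

(** The gap drops by at most 1, so the chain stays in B until it is stopped. *)
Lemma step_jump_B y a : B y -> gap y != 0 -> B (step y (jump a)).
Proof.
move=> yB g0; split; first by apply: step_state_space; case: yB.
rewrite -subr_ge0 -/(gap _) /step; case: ifP => _; last exact: B_gap.
rewrite gapD; have := B_gap yB; have := gap_jump_ge a; move: g0.
move: (gap y) (gap _) => p q; lia.
Qed.

(** An increment is recognized by the coordinate at which it is -1; only the
    service at the first queue has no such coordinate. *)
Lemma jump_inj : injective jump.
Proof.
have jumpN1 a l : (jump a 0 l == -1) =
    if a is Some j then (j != ord0) && (l == j) else l == ord0.
  case: a => [j|] /=; last by rewrite arrivalE; case: (l == ord0).
  rewrite serviceE; case: (eqVneq j ord0) => _ /=.
    by case: (l == j); case: (l == j.+1 :> nat).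
  case: (eqVneq l j) => [->|_]; last by case: (l == j.+1 :> nat).
  by rewrite [j == j.+1 :> nat]ltn_eqF.
move=> a b eab; have e l := congr1 (fun v : 'rV_n.+2 => v 0 l == -1) eab.
have {eab}e l := etrans (esym (jumpN1 a l)) (etrans (e l) (jumpN1 b l)).
move: e; case: a => [i|]; case: b => [j|] // e.
- have := e i; have := e j; rewrite !eqxx !andbT.
  case: (eqVneq i ord0) => [->|i0] /=; case: (eqVneq j ord0) => [->|j0]//=.
  by move=> /eqP->.
- by have := e ord0; rewrite eqxx; case: (eqVneq i ord0) => //= i0 /esym;
    rewrite eq_sym (negPf i0).
- by have := e ord0; rewrite eqxx; case: (eqVneq j ord0) => //= j0;
    rewrite eq_sym (negPf j0).
Qed.
End StateSpace.

Lemma big_option (R : nmodType) (T : finType) (F : option T -> R) :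
  \sum_a F a = F None + \sum_i F (Some i).
Proof.
rewrite (bigD1 None)//=; congr (_ + _).
rewrite (reindex_omap Some id) => [|[]]//.
by apply: eq_bigl => i; rewrite eqxx.
Qed.

Section Hitting.
Variables (R : realType) (n : nat) (lam : R) (mu : 'I_n.+2 -> R).
Implicit Types (y v : 'rV[int]_n.+2) (j : 'I_n.+2) (s : seq 'I_n.+2).
Implicit Types (f : 'rV[int]_n.+2 -> R) (m : R).

Definition rate (a : option 'I_n.+2) : R := if a is Some j then mu j else lam.

Definition mean f y : R := \sum_a rate a * f (step y (jump a)).

(** P_y(tau <= k), computed by conditioning on the first step. *)
Fixpoint hit_prob (k : nat) y : R :=
  if gap y == 0 then 1 else
  if k is k'.+1 then mean (hit_prob k') y else 0.

Hypothesis lam_gt0 : 0 < lam.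
Hypothesis sum_rates : lam + \sum_(j < n.+2) mu j = 1.
Hypothesis stable : forall j, lam < mu j.

Lemma rate_ge0 a : 0 <= rate a.
Proof. by case: a => [j|] /=; rewrite ltW// (lt_trans lam_gt0). Qed.

Lemma sum_rate : \sum_a rate a = 1.
Proof. by rewrite big_option. Qed.

Lemma mean_cst c y : mean (fun=> c) y = c.
Proof. by rewrite /mean -mulr_suml sum_rate mul1r. Qed.

Lemma mean_le f g y : (forall a, f (step y (jump a)) <= g (step y (jump a))) ->
  mean f y <= mean g y.
Proof. by move=> fg; apply: ler_sum => a _; rewrite ler_wpM2l ?rate_ge0. Qed.

Lemma mean_lin c f e g y :
  mean (fun z => c * f z + e * g z) y = c * mean f y + e * mean g y.
Proof.
rewrite /mean !mulr_sumr -big_split; apply: eq_bigr => a _ /=; ring.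
Qed.

Lemma norm_mean f y : `|mean f y| <= mean (fun z => `|f z|) y.
Proof.
rewrite /mean (le_trans (ler_norm_sum _ _ _))// ler_sum// => a _.
by rewrite normrM ger0_norm ?rate_ge0.
Qed.

Lemma hit_prob_ge0_le1 k y : 0 <= hit_prob k y <= 1.
Proof.
elim: k y => [|k IH] y /=; case: ifP => _; rewrite ?ler01 ?lexx//.
rewrite -[X in X <= _ <= _](mean_cst _ y) -[X in _ <= _ <= X](mean_cst _ y).
by apply/andP; split; apply: mean_le => a; case/andP: (IH (step y (jump a))).
Qed.

Lemma hit_prob_nondecreasing y : {homo hit_prob^~ y : k l / (k <= l)%N >-> k <= l}.
Proof.
apply/nondecreasing_seqP => k; elim: k y => [|k IH] y /=; case: ifP => //= g0.
  rewrite -[X in X <= _](mean_cst _ y).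
  by apply: mean_le => a; case/andP: (hit_prob_ge0_le1 0 (step y (jump a))).
by apply: mean_le => a; apply: IH.
Qed.

(** Arrivals are never blocked, so a run of them brings the gap down to 0. *)
Lemma hit_prob_ge k y : B y -> gap y <= k%:Z -> lam ^+ k <= hit_prob k y.
Proof.
have lam1 : lam <= 1.
  rewrite -sum_rates lerDl sumr_ge0// => j _.
  by rewrite ltW// (lt_trans lam_gt0).
elim: k y => [|k IH] y yB gk /=.
  by rewrite eq_le gk B_gap.
case: ifPn => [_|g0]; first by rewrite exprn_ile1// ltW.
have aB := step_jump_B None yB g0; case: (yB) => yS _.
rewrite /mean (bigD1 None)//= exprS -[X in X <= _]addr0 lerD//.
  apply: ler_wpM2l; first exact: ltW.
  apply: IH => //; rewrite step_arrival// gapD gap_arrival.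
  move: gk; move: (gap y) => p; lia.
rewrite sumr_ge0// => a _; rewrite mulr_ge0 ?rate_ge0//.
by case/andP: (hit_prob_ge0_le1 k (step y (jump a))).
Qed.

(** The error u - hit_prob k is the mean of u over the unstopped paths of length
    k.  Those that end at a gap larger than M contribute at most C * r ^+ M; the
    others are stopped within the next M steps with probability at least
    lam ^+ M, so they are controlled by the increase of hit_prob from k to
    k + M.  The inequality is propagated in k by the one-step mean. *)
Lemma hit_prob_error (r C : R) (u : 'rV[int]_n.+2 -> R) (M : nat) :
  0 <= r <= 1 -> 0 <= C ->
  (forall y, B y -> gap y = 0 -> u y = 1) ->
  (forall y, B y -> mean u y = u y) ->
  (forall y, B y -> `|u y| <= C * r ^+ `|gap y|%N) ->
  forall k y, B y ->
  lam ^+ M * (`|u y - hit_prob k y| - C * r ^+ M)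
    <= C * (hit_prob (k + M) y - hit_prob k y).
Proof.
move=> /andP[r0 r1] C0 u1 uh ub.
(* the inequality at the stopped states, where the error is 0 *)
have base z : 0 <= z -> lam ^+ M * (0 - C * r ^+ M) <= C * z.
  move=> z0; rewrite (@le_trans _ _ 0)// ?mulr_ge0//.
  by rewrite sub0r mulrN oppr_le0 !mulr_ge0// exprn_ge0// ltW.
elim=> [|k IH] y yB.
  have /andP[h0 _] := hit_prob_ge0_le1 M y.
  rewrite add0n /=; case: ifPn => [/eqP g0|g0].
    rewrite u1// subrr normr0; apply: base.
    by case: M h0 => [|M'] /=; rewrite g0 eqxx subrr.
  rewrite !subr0; have [gM|Mg] := leP (gap y) M%:Z.
    have uC : `|u y| <= C.
      by rewrite (le_trans (ub _ yB))// ler_piMr// exprn_ile1.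
    apply: (@le_trans _ _ (lam ^+ M * C)).
      rewrite ler_wpM2l ?exprn_ge0 ?(ltW lam_gt0)//.
      by rewrite lerBlDr (le_trans uC)// lerDl mulr_ge0 ?exprn_ge0.
    by rewrite mulrC ler_wpM2l ?hit_prob_ge.
  apply: (@le_trans _ _ 0); last exact: mulr_ge0.
  rewrite mulr_ge0_le0 ?exprn_ge0 ?(ltW lam_gt0)// subr_le0.
  rewrite (le_trans (ub _ yB))// ler_wpM2l// ler_wiXn2l// -lez_nat.
  by rewrite gez0_abs ?B_gap// ltW.
rewrite addSn /=; case: ifPn => [/eqP g0|g0].
  by rewrite u1// subrr normr0; apply: base.
have meanB f g : mean f y - mean g y = mean (fun z => 1 * f z + (-1) * g z) y.
  by rewrite mean_lin mul1r mulN1r.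
rewrite -(uh y yB) !meanB.
apply: (@le_trans _ _ (mean (fun z => lam ^+ M *
    `|1 * u z + -1 * hit_prob k z| + (- lam ^+ M * C * r ^+ M) * 1) y)).
  rewrite (mean_lin _ _ _ (fun=> 1)) mean_cst mulrBr -mulrA mulNr mulr1 lerD2r.
  by rewrite ler_wpM2l ?exprn_ge0 ?(ltW lam_gt0)// norm_mean.
rewrite -[C * _]addr0 -[X in _ + X](mul0r (mean u y)) -mean_lin.
apply: mean_le => a; rewrite mul0r addr0 !mul1r !mulN1r mulr1 !mulNr.
by rewrite -mulrA -mulrBr IH//; apply: step_jump_B.
Qed.

(** The sequence hit_prob k y is monotone and bounded, hence convergent, so its
    increments over M steps tend to 0: let k, then M, go to infinity in
    hit_prob_error. *)
Lemma cvg_hit_prob (r C : R) (u : 'rV[int]_n.+2 -> R) y :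
  0 <= r < 1 -> 0 <= C ->
  (forall y, B y -> gap y = 0 -> u y = 1) ->
  (forall y, B y -> mean u y = u y) ->
  (forall y, B y -> `|u y| <= C * r ^+ `|gap y|%N) ->
  B y -> hit_prob k y @[k --> \oo] --> u y.
Proof.
move=> /andP[r0 r1] C0 u1 uh ub yB.
have /cvg_ex[L hL] : cvgn (hit_prob^~ y).
  apply: nondecreasing_is_cvgn; first exact: hit_prob_nondecreasing.
  by exists 1 => _ [k _ <-]; case/andP: (hit_prob_ge0_le1 k y).
suff -> : u y = L by [].
have bound M : lam ^+ M * (`|u y - L| - C * r ^+ M) <= 0.
  have hLM : hit_prob (k + M) y @[k --> \oo] --> L.
    by have h := cvg_shiftn M (hit_prob^~ y) (nbhs L); rewrite -h in hL.
  have lhs : lam ^+ M * (`|u y - hit_prob k y| - C * r ^+ M) @[k --> \oo]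
      --> lam ^+ M * (`|u y - L| - C * r ^+ M).
    apply: cvgMr; apply: cvgB; last exact: cvg_cst.
    by apply: cvg_norm; apply: cvgB => //; apply: cvg_cst.
  have rhs : C * (hit_prob (k + M) y - hit_prob k y) @[k --> \oo] --> (0 : R).
    by rewrite -(mulr0 C) -(subrr L); apply: cvgMr; apply: cvgB.
  apply: (ler_cvg_to lhs rhs); apply: nearW => k.
  by apply: (hit_prob_error M _ C0 u1 uh ub k yB); rewrite r0 ltW.
apply/eqP; rewrite -subr_eq0 -normr_le0.
have rhs : C * r ^+ M @[M --> \oo] --> (0 : R).
  by rewrite -(mulr0 C); apply: cvgMr; apply: cvg_expr; rewrite ger0_norm.
have lhs : `|u y - L| @[M --> \oo] --> `|u y - L| by exact: cvg_cst.
apply: (ler_cvg_to lhs rhs); apply: nearW => M; rewrite -subr_le0.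
by have := bound M; rewrite pmulr_rle0 ?exprn_gt0.
Qed.
End Hitting.

(** * The escape function solves the hitting problem *)

Section Solution.
Variables (R : realType) (n : nat) (lam : R) (mu : 'I_n.+2 -> R).
Implicit Types (y v : 'rV[int]_n.+2) (j : 'I_n.+2) (s : seq 'I_n.+2).

Definition no_hit y : R := escape lam mu lam (queues_from 0) y.

Hypothesis lam_gt0 : 0 < lam.
Hypothesis sum_rates : lam + \sum_(j < n.+2) mu j = 1.
Hypothesis stable : forall j, lam < mu j.
Hypothesis mu_distinct : forall i j : 'I_n.+2, i != j -> mu i != mu j.

Lemma factor_lam j y : factor lam mu lam j y = 1.
Proof.
rewrite /factor !divff ?exp1rz ?mulr1//; first exact: lt0r_neq0.
by rewrite subr_eq0 gt_eqF.
Qed.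

(** The factor of the first queue is a power of lam / lam = 1: the coordinate
    y(1) enters through the gap only. *)
Lemma no_hitE y : no_hit y =
  escape lam mu lam (queues_from 1) y -
  escape lam mu (mu ord0) (queues_from 1) y.
Proof. by rewrite /no_hit (queues_fromE ord0) /= factor_lam mul1r. Qed.

Lemma no_hit_gap0 y : gap y = 0 -> no_hit y = 0.
Proof. by move=> g0; apply: escape_gap0; rewrite ?(queues_fromE ord0). Qed.

Lemma meanE f y : state_space y ->
  mean lam mu f y = f y + mu ord0 * (f (y + service ord0) - f y)
                    + drift lam mu (queues_from 1) f y.
Proof.
move=> yS; have sumE (F : 'I_n.+2 -> R) :
    \sum_j F j = F ord0 + \sum_(j <- queues_from 1) F j.
  by rewrite -big_enum -[enum _]drop0 -/(queues_from 0) (queues_fromE ord0) big_cons.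
rewrite /mean big_option /drift step_arrival//= sumE.
have -> : \sum_(j <- queues_from 1) mu j * f (step y (service j)) =
    \sum_(j <- queues_from 1) mu j * f y +
    \sum_(j <- queues_from 1 | 0 < y 0 j) mu j * (f (y + service j) - f y).
  rewrite [X in _ = _ + X]big_mkcond -big_split/=; apply: eq_big_seq => j.
  rewrite mem_queues_from step_service// -val_eqE eqn0Ngt => -> /=.
  by case: ifP => _; ring.
rewrite step_service//= -mulr_suml.
have -> : \sum_(j <- queues_from 1) mu j = 1 - lam - mu ord0.
  by rewrite -sum_rates sumE; ring.
ring.
Qed.

(** The drift from the queues other than the first is read off drift_escape.
    What remains, from the term of parameter mu ord0, is compensated by the
    service at the first queue, which is never blocked. *)
Lemma mean_no_hit y : B y -> mean lam mu no_hit y = no_hit y.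
Proof.
move=> yB; have [yS _] := yB; rewrite meanE//.
have -> : drift lam mu (queues_from 1) no_hit y =
    (mu ord0 - lam) * - escape lam mu (mu ord0) (queues_from 1) y.
  transitivity (drift lam mu (queues_from 1) (fun z =>
    escape lam mu lam (queues_from 1) z -
    escape lam mu (mu ord0) (queues_from 1) z) y).
    by apply: eq_drift => [||j _]; rewrite no_hitE.
  rewrite driftB !drift_escape//; first ring.
  - exact: (mu_neq0 lam_gt0 stable).
  - by move=> j j0; apply: mu_distinct; rewrite -val_eqE -lt0n.
  - by move=> j _; apply: B_coord_ge0.
  - exact: lt0r_neq0.
  - by move=> j _; rewrite gt_eqF.
  - by move=> j _; apply: B_coord_ge0.
have serve m : m != 0 -> escape lam mu m (queues_from 1) (y + service ord0) =
    lam / m * escape lam mu m (queues_from 1) y.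
  exact: (escape_service mu lam_gt0 ord0 y).
rewrite !no_hitE !serve ?(lt0r_neq0 lam_gt0) ?(mu_neq0 lam_gt0 stable)//.
by field; rewrite (lt0r_neq0 lam_gt0) (mu_neq0 lam_gt0 stable).
Qed.

Lemma exists_rho_bound : exists2 r : R, 0 <= r < 1 & forall j, lam / mu j <= r.
Proof.
have mu0 j : 0 < mu j by apply: lt_trans (stable j).
exists (\big[Num.max/0]_j (lam / mu j)) => [|j]; last exact: le_bigmax.
apply/andP; split; first exact: bigmax_ge_id.
by apply: bigmax_lt => // j _; rewrite ltr_pdivrMr// mul1r.
Qed.

Lemma escape_bound r s i : 0 <= r < 1 -> (forall j, lam / mu j <= r) ->
  exists2 C, 0 <= C &
    forall y, B y -> `|escape lam mu (mu i) s y| <= C * r ^+ `|gap y|%N.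
Proof.
move=> /andP[r0 r1] hr.
have rho_ge0 j : 0 <= lam / mu j.
  by rewrite divr_ge0 ?(ltW lam_gt0)// ltW// (lt_trans lam_gt0).
elim: s i => [|j s IH] i.
  exists 1 => // y /B_gap; rewrite mul1r /=; case: (gap y) => // k _.
  rewrite -exprnP normrX absz_nat ger0_norm//.
  by apply: lerXn2r; rewrite ?nnegrE.
have [C1 C10 h1] := IH i; have [C2 C20 h2] := IH j.
exists (`|(mu j - lam) / (mu j - mu i)| * (C1 + C2)) => [|y yB].
  by rewrite mulr_ge0 ?addr_ge0.
rewrite /= normrM -mulrA ler_pM// => [|].
  rewrite /factor normrM ler_piMr//; have := B_coord_ge0 yB j.
  case: (y 0 j) => // k _; rewrite -exprnP normrX exprn_ile1//.
  by rewrite ger0_norm// (le_trans (hr i))// ltW.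
by rewrite (le_trans (ler_normB _ _))// mulrDl lerD ?h1 ?h2.
Qed.

(** The constant 1 = (lam / lam) ^ gap y is the only term of the expansion of
    escape lam that does not decay with the gap; escape_bound covers the
    others. *)
Lemma hit_bound r s : 0 <= r < 1 -> (forall j, lam / mu j <= r) ->
  exists2 C, 0 <= C &
    forall y, B y -> `|1 - escape lam mu lam s y| <= C * r ^+ `|gap y|%N.
Proof.
move=> r01 hr; have lam0 := lt0r_neq0 lam_gt0; elim: s => [|j s [C C0 h]].
  by exists 0 => // y _ /=; rewrite divff// exp1rz subrr normr0 mul0r.
have [C1 C10 h1] := escape_bound s j r01 hr.
exists (C + C1) => [|y yB /=]; first exact: addr_ge0.
rewrite factor_lam mul1r opprB addrCA addrC.
by rewrite (le_trans (ler_normD _ _))// mulrDl lerD ?h ?h1.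
Qed.

Lemma cvg_hit_prob_no_hit y : B y ->
  hit_prob lam mu k y @[k --> \oo] --> 1 - no_hit y.
Proof.
move=> yB; have [r r01 hr] := exists_rho_bound.
have [C C0 hC] := hit_bound (queues_from 0) r01 hr.
apply: (cvg_hit_prob lam_gt0 sum_rates stable (u := fun y => 1 - no_hit y) r01 C0).
- by move=> z _ z0; rewrite no_hit_gap0// subr0.
- move=> z zB; rewrite -[in RHS](mean_no_hit zB) -{2}(mean_cst sum_rates 1 z).
  rewrite -[mean _ _ (fun=> 1) z]mul1r -mulN1r -mean_lin; congr mean.
  by apply/funext => x; rewrite mul1r mulN1r.
- exact: hC.
- exact: yB.
Qed.
End Solution.

(** * The hitting time of the chain *)

Section HittingEvent.
Variables (n : nat) (T : Type) (I : nat -> T -> 'rV[int]_n.+2).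

(** The event that the chain started from y at time m and driven by the
    increments I m, I m.+1, ... has gap 0 at one of its first k steps. *)
Fixpoint hit_event (k m : nat) (y : 'rV[int]_n.+2) : set T :=
  if gap y == 0 then setT else
  if k is k'.+1 then [set w | hit_event k' m.+1 (step y (I m w)) w] else set0.

(** The chain is defined by its last step; conditioning on the first increment
    requires the recursion on the first step. *)
Lemma chain_shift (J : nat -> T -> 'rV[int]_n.+2) y (k : nat) w :
  chain J y k.+1 w = chain (fun i => J i.+1) (step y (J 0%N w)) k w.
Proof. by elim: k => [|k IH] //; rewrite /= -IH. Qed.

Lemma hit_eventP (k m : nat) y w : hit_event k m y w <->
  exists2 i, (i <= k)%N & gap (chain (fun i => I (m + i)) y i w) = 0.
Proof.
elim: k m y => [|k IH] m y /=; case: eqP => g0.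
- by split=> // _; exists 0%N.
- by split=> // -[[|i]].
- by split=> // _; exists 0%N.
have E i : chain (fun i => I (m + i)) y i.+1 w =
    chain (fun i => I (m.+1 + i)) (step y (I m w)) i w.
  rewrite chain_shift addn0; congr chain.
  by apply/funext => j; rewrite addSnnS.
apply: (iff_trans (IH _ _)); split=> [[i ik ci]|[[|i] ik] //].
  by exists i.+1; rewrite ?E.
by rewrite E => ci; exists i.
Qed.

Lemma tau_lt_pinfty (R : realType) y :
  [set w | (tau R (chain I y) w < +oo)%E] = \bigcup_k hit_event k 0 y.
Proof.
apply/seteqP; split=> w /=.
  move/ereal_inf_ltP => [_ [k /= ck <-] _]; exists k => //.
  by apply/hit_eventP; exists k => //; rewrite /gap ck subrr.
move=> [k _ /hit_eventP[i _ /eqP]]; rewrite subr_eq0 => /eqP ci.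
by apply/ereal_inf_ltP; exists i%:R%:E; [exists i|rewrite ltry].
Qed.
End HittingEvent.

Section HittingProbability.
Variables (R : realType) (n : nat) (lam : R) (mu : 'I_n.+2 -> R).
Variables (d : measure_display) (T : measurableType d) (P : probability T R).
Variable I : nat -> T -> 'rV[int]_n.+2.
Hypothesis I_iid : iid_increments P lam mu I.
Hypothesis sum_rates : lam + \sum_(j < n.+2) mu j = 1.
Implicit Types (y v : 'rV[int]_n.+2) (k m : nat).

Lemma measurable_increment m A : measurable (I m @^-1` A).
Proof. by case: I_iid => mI _ _ _; apply: mI. Qed.

Lemma increment_jump m a : P (I m @^-1` [set jump a]) = (rate lam mu a)%:E.
Proof.
by case: I_iid => _ _ Plam Pmu; case: a => [j|]; [apply: Pmu|apply: Plam].
Qed.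

(** The step is random with values in a countable type, which makes the event a
    countable union over the possible values of the increment. *)
Lemma measurable_hit_event k m y : measurable (hit_event I k m y).
Proof.
elim: k m y => [|k IH] m y /=; case: ifP => _ //.
rewrite (_ : [set w | _] = \bigcup_(v in setT)
    (I m @^-1` [set v] `&` hit_event I k m.+1 (step y v))).
  apply: countable_bigcupT_measurable => [|v]; first exact: countableP.
  by apply: measurableI => //; apply: measurable_increment.
by apply/seteqP; split=> [w hw|w [v _ [/= <-]]] //; exists (I m w).
Qed.

(** The rates add up to 1, so an increment takes one of the values jump a almost
    surely; elsewhere it is arbitrary. *)
Lemma measure_split_jump m (E : set T) : measurable E ->
  P E = (\sum_a P (E `&` I m @^-1` [set jump a]))%E.
Proof.
move=> mE; pose U a := I m @^-1` [set jump a].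
pose D := [set` index_enum (option 'I_n.+2)].
have mU a : measurable (U a) by exact: measurable_increment.
have tU : trivIset D U.
  apply/trivIsetP => a b _ _ ab; apply/seteqP; split=> // w [/= ea eb].
  by move: ab; rewrite (jump_inj (etrans (esym ea) eb)) eqxx.
have sumD (F : option 'I_n.+2 -> \bar R) :
    (\sum_a F a = \sum_(a \in D) F a)%E.
  exact: fsbig_seq (index_enum_uniq _).
have mUU : measurable (\bigcup_(a in D) U a).
  by apply: fin_bigcup_measurable => //; apply: finite_seq.
have PU : P (~` \bigcup_(a in D) U a) = 0.
  rewrite probability_setC// measure_fin_bigcup//; last exact: finite_seq.
  rewrite -sumD (eq_bigr _ (fun a _ => increment_jump m a)).
  by rewrite sumEFin big_option sum_rates subee.
rewrite (measureDI P mE mUU) [X in (X + _)%E](_ : _ = 0%E) ?add0e; last first.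
  apply: subset_measure0 PU; [exact: measurableD|exact: measurableC|].
  by move=> w [].
rewrite setI_bigcupr measure_fin_bigcup ?sumD//.
- exact: finite_seq.
- exact: trivIset_setIl.
- by move=> a _; apply: measurableI.
Qed.

Definition past m (A : nat -> set 'rV[int]_n.+2) : set T :=
  \bigcap_(k in `I_m) (I k @^-1` A k).

Lemma measurable_past m A : measurable (past m A).
Proof.
apply: fin_bigcap_measurable => [|k _]; first exact: finite_II.
exact: measurable_increment.
Qed.

(** Fixing one more increment yields again an event of the same form, with the
    probability given by independence. *)
Lemma past_jump m A a :
  exists A', past m A `&` I m @^-1` [set jump a] = past m.+1 A' /\
             P (past m.+1 A') = (P (past m A) * (rate lam mu a)%:E)%E.
Proof.
have [_ indep _ _] := I_iid.
exists (fun k => if k == m then [set jump a] else A k); split.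
  apply/seteqP; split=> [w [pw Imw] k /=|w pw].
    by rewrite ltnS leq_eqVlt; case: eqP => [->//|_ /= km]; apply: pw.
  split=> [k /= km|]; last by have := pw m (ltnSn m); rewrite /= eqxx.
  by have := pw k (ltnW km); rewrite /= (ltn_eqF km).
have pastE m' A' : P (past m' A') =
    (\prod_(k <- iota 0 m') P (I k @^-1` A' k))%E.
  rewrite -indep ?iota_uniq//; congr (P _); congr (\bigcap_(k in _) _).
  by apply/seteqP; split=> k /=; rewrite mem_iota.
rewrite !pastE -addn1 iotaD big_cat/= big_seq1 add0n eqxx.
rewrite increment_jump; congr (_ * _)%E; apply: eq_big_seq => k.
by rewrite mem_iota => /andP[_ km]; rewrite ltn_eqF.
Qed.

(** The Markov property, for the events past m A only: this is all that the
    induction on k uses, since each step replaces past m A by past m.+1 A'. *)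
Lemma measure_past_hit k m A y :
  P (past m A `&` hit_event I k m y) =
  (P (past m A) * (hit_prob lam mu k y)%:E)%E.
Proof.
elim: k m A y => [|k IH] m A y /=; case: ifPn => g0.
- by rewrite setIT mule1.
- by rewrite setI0 measure0 mule0.
- by rewrite setIT mule1.
rewrite (measure_split_jump m); last first.
  apply: measurableI; first exact: measurable_past.
  by have := measurable_hit_event k.+1 m y; rewrite /= (negPf g0).
have /fineK <- : P (past m A) \is a fin_num.
  exact: fin_num_measure (measurable_past m A).
rewrite -EFinM /mean mulr_sumr -sumEFin; apply: eq_bigr => a _.
have [A' [eA' PA']] := past_jump m A a.
rewrite mulrA EFinM EFinM fineK ?fin_num_measure//; last exact: measurable_past.
rewrite -PA' -IH; congr (P _); rewrite -eA'.
by apply/seteqP; split=> [w [[pw /= hw] Iw]|w [[pw /= Iw] hw]];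
  do ?split => //=; rewrite -?Iw // Iw.
Qed.

Lemma measure_hit_event k y : P (hit_event I k 0 y) = (hit_prob lam mu k y)%:E.
Proof.
have pastT : past 0 (fun=> setT) = setT by apply/seteqP.
have := measure_past_hit k 0 (fun=> setT) y.
by rewrite pastT setTI probability_setT mul1e.
Qed.

Lemma probability_tau y (l : R) : hit_prob lam mu k y @[k --> \oo] --> l ->
  P [set w | (tau R (chain I y) w < +oo)%E] = l%:E.
Proof.
move=> hl; rewrite tau_lt_pinfty.
have h : (P \o (fun k => hit_event I k 0 y)) k @[k --> \oo] -->
    P (\bigcup_k hit_event I k 0 y).
  apply: nondecreasing_cvg_mu => [k||k l' kl].
  - exact: measurable_hit_event.
  - by apply: bigcup_measurable => k _; apply: measurable_hit_event.
  - apply/subsetPset => w /hit_eventP[i ik ci]; apply/hit_eventP.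
    by exists i => //; apply: leq_trans kl.
apply: (cvg_unique _ h) => //.
have -> : P \o (fun k => hit_event I k 0 y) = EFin \o (hit_prob lam mu ^~ y).
  by apply/funext => k /=; rewrite measure_hit_event.
by apply: cvg_EFin; [exact: nearW|exact: hl].
Qed.
End HittingProbability.

(** * Expansion of the escape function over the sets of queues *)

Lemma big_subset_setU1 (R : nmodType) (T : finType) (x : T) (A : {set T})
    (F : {set T} -> R) : x \notin A ->
  \sum_(b : {set T} | b \subset (x |: A)%SET) F b =
  \sum_(b : {set T} | b \subset A) (F b + F (x |: b)%SET).
Proof.
move=> xA; rewrite (bigID (fun b : {set T} => x \in b))/= addrC big_split/=.
congr (_ + _).
  by apply: eq_bigl => b; rewrite -subsetD1 setU1K.
rewrite (reindex_onto (fun b => x |: b)%SET (fun b => b :\ x)%SET) => [|b];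
  last first.
  by case/andP => _ /finset.setD1K.
apply: eq_bigl => b; apply/idP/idP => [/andP[/andP[bA _] /eqP bx]|bA].
  by rewrite -bx finset.subDset.
have xb : x \notin b by apply: contra xA; apply: (fintype.subsetP bA).
by rewrite finset.setUS// finset.setU11 finset.setU1K//= eqxx.
Qed.

Section Elements.
Variable n : nat.
Implicit Types (a b : {set 'I_n.+2}) (i j k : 'I_n.+2) (p q : nat).

Lemma enum_sorted b : sorted (fun i j => i < j)%N (enum b).
Proof.
rewrite /enum_mem sorted_filter//; first by move=> j i k; apply: ltn_trans.
rewrite -enumT; have := iota_ltn_sorted 0 n.+2.
by rewrite -val_enum_ord sorted_map.
Qed.

Lemma elt_le b p q : (p <= q < #|b|)%N -> (elt b p <= elt b q)%N.
Proof.
move=> /andP[pq qb].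
have leT : transitive (fun i j => i <= j)%N by move=> j i k; apply: leq_trans.
apply: (sorted_leq_nth leT (fun=> leqnn _)) => //.
- by apply: sub_sorted (enum_sorted b) => i j; apply: ltnW.
- by rewrite inE -cardE (leq_ltn_trans pq).
- by rewrite inE -cardE.
Qed.

Definition max_elt b : 'I_n.+2 := elt b #|b|.-1.

Lemma max_elt_mem b : b != finset.set0 -> max_elt b \in b.
Proof.
rewrite -card_gt0 => b0; rewrite -mem_enum; apply: mem_nth.
by rewrite -cardE prednK.
Qed.

Lemma max_elt_ge b i : i \in b -> (i <= max_elt b)%N.
Proof.
rewrite -mem_enum => ib; rewrite -{1}(nth_index ord0 ib).
have := ib; rewrite -index_mem -cardE => ltb; apply: elt_le.
by case: #|b| ltb => // c; rewrite ltnS => ->/=.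
Qed.

Lemma max_elt_setU1 k a : a \subset [set i : 'I_n.+2 | (i < k)%N]%SET ->
  max_elt (k |: a)%SET = k.
Proof.
move=> ak; have kb : k \in (k |: a)%SET by apply: finset.setU11.
apply/eqP; rewrite -val_eqE eqn_leq max_elt_ge// andbT.
have /max_elt_mem : (k |: a)%SET != finset.set0 by apply/set0Pn; exists k.
by case/setU1P => [->//|/(fintype.subsetP ak)]; rewrite inE => /ltnW.
Qed.

(** A nonempty set is its maximum k together with a set of elements below k. *)
Lemma sum_by_max_elt (R : nmodType) (F : {set 'I_n.+2} -> R) :
  \sum_(b | b != finset.set0) F b =
  \sum_(k < n.+2)
    \sum_(a : {set 'I_n.+2} | a \subset [set i : 'I_n.+2 | (i < k)%N]%SET)
      F (k |: a)%SET.
Proof.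
rewrite (partition_big max_elt xpredT)//=; apply: eq_bigr => k _.
rewrite (reindex_onto (fun a => k |: a)%SET (fun b => b :\ k)%SET) => [|b];
  last first.
  by case/andP => b0 /eqP bk; rewrite finset.setD1K// -bk max_elt_mem.
apply: eq_bigl => a; apply/idP/idP => [/andP[/andP[_ /eqP mk] /eqP ka]|ak].
  apply/fintype.subsetP => i ia; rewrite inE ltn_neqAle -{2}mk.
  rewrite max_elt_ge ?finset.setU1r// andbT.
  by apply: contraTneq ia => /val_inj->; rewrite -ka finset.setD11.
have ka : k \notin a.
  by apply/negP => /(fintype.subsetP ak); rewrite inE ltnn.
rewrite max_elt_setU1// finset.setU1K// !eqxx !andbT.
by apply/set0Pn; exists k; apply: finset.setU11.
Qed.
End Elements.

Section Expansion.
Variables (R : realType) (n : nat) (lam : R) (mu : 'I_n.+2 -> R).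
Implicit Types (y : 'rV[int]_n.+2) (j : 'I_n.+2) (s e : seq 'I_n.+2).
Implicit Types (m : R) (b : {set 'I_n.+2}).

(** One term of the expansion of escape: at each queue j the set b chooses
    between the two terms of the difference, so that, after the first choice,
    m is the service rate of the last chosen queue. *)
Fixpoint escape_term b m s y : R :=
  if s is j :: s' then
    factor lam mu m j y *
      (if j \in b then - escape_term b (mu j) s' y else escape_term b m s' y)
  else (lam / m) ^ gap y.

Lemma eq_escape_term b b' m s y : {in s, b =i b'} ->
  escape_term b m s y = escape_term b' m s y.
Proof.
elim: s m => //= j s IH m bb'; rewrite bb' ?mem_head// !IH// => i si;
  by apply: bb'; rewrite in_cons si orbT.
Qed.

Lemma escape_expand m (l : nat) y :
  escape lam mu m (queues_from l) y =
  \sum_(b : {set 'I_n.+2} | b \subset [set i in queues_from l]%SET)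
    escape_term b m (queues_from l) y.
Proof.
move: l m; apply: (queues_from_ind (Q := fun s => forall m,
  escape lam mu m s y =
  \sum_(b : {set 'I_n.+2} | b \subset [set i in s]%SET) escape_term b m s y)).
  move=> m /=; rewrite (big_pred1 finset.set0)// => b.
  by rewrite finset.set_nil finset.subset0.
move=> j IH m; rewrite finset.set_cons big_subset_setU1; last first.
  by rewrite inE mem_queues_from ltnn.
rewrite /= !IH -sumrB mulr_sumr; apply: eq_bigr => b bj.
have jb : j \notin b.
  by apply/negP => /(fintype.subsetP bj); rewrite inE mem_queues_from ltnn.
rewrite (negPf jb) finset.setU11 -mulrDr; congr (_ * (_ - _)).
apply: eq_escape_term => i; rewrite mem_queues_from in_setU1 => ji.
by case: eqP ji => // ->; rewrite ltnn.
Qed.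

Lemma escape_term_skip b m (l k : nat) y : (l <= k <= n.+2)%N ->
  (forall i : 'I_n.+2, (l <= i < k)%N -> i \notin b) ->
  escape_term b m (queues_from l) y =
  \prod_(j : 'I_n.+2 | (l <= j < k)%N) factor lam mu m j y *
  escape_term b m (queues_from k) y.
Proof.
have [c] := ubnP (k - l); elim: c l => // c IH l kl /andP[lk kn] nb.
have [lk'|kl'] := ltnP l k; last first.
  have -> : l = k by apply/eqP; rewrite eqn_leq lk.
  by rewrite big1 ?mul1r// => j /andP[/leq_ltn_trans h /h]; rewrite ltnn.
pose j0 := Ordinal (leq_trans lk' kn).
rewrite (queues_fromE j0) /= (negPf (nb j0 _)) ?leqnn// IH.
- rewrite mulrA [in RHS](bigD1 j0) /= ?leqnn//; congr (_ * _ * _).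
  apply: eq_bigl => j; rewrite -val_eqE/=.
  by rewrite [RHS]andbC andbA [(l < j)%N]ltn_neqAle [(l : nat) == _]eq_sym.
- by rewrite subnS -ltnS prednK ?subn_gt0.
- by rewrite lk'.
- by move=> i /andP[li ik]; apply: nb; rewrite ik ltnW.
Qed.

(** Between two consecutive elements of b the parameter is constant, which groups
    the factors by the intervals that define c_star and alpha_star. *)
Lemma escape_term_runs b k e y : path (fun i j => i < j)%N k e ->
  (forall i : 'I_n.+2, (k < i)%N -> (i \in b) = (i \in e)) ->
  escape_term b (mu k) (queues_from k.+1) y =
  (-1) ^+ size e *
  (\prod_(p < size e)
     \prod_(j : 'I_n.+2 | (nth ord0 (k :: e) p < j <= nth ord0 (k :: e) p.+1)%N)
       factor lam mu (mu (nth ord0 (k :: e) p)) j y *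
   \prod_(j : 'I_n.+2 | (last k e < j)%N) factor lam mu (mu (last k e)) j y *
   (lam / mu (last k e)) ^ gap y).
Proof.
elim: e k => [|i e IH] k /= pe eb.
  rewrite (@escape_term_skip _ _ k.+1 n.+2) ?leqnn ?ltn_ord//; last first.
    by move=> i /andP[/eb->].
  rewrite (queues_from_nil (leqnn _)) big_ord0 !mul1r; congr (_ * _).
  by apply: eq_bigl => j; rewrite ltn_ord andbT.
have /andP[ki pie] := pe.
have lt_e j : j \in e -> (i < j)%N.
  move=> je; have ltT : transitive (fun i j : 'I_n.+2 => i < j)%N.
    by move=> ? ? ?; apply: ltn_trans.
  exact: (allP (order_path_min ltT pie)).
rewrite (@escape_term_skip _ _ k.+1 i) ?ki ?(ltnW (ltn_ord i))//; last first.
  move=> j /andP[kj ji]; rewrite eb// in_cons -val_eqE/= (ltn_eqF ji)/=.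
  by apply/negP => /lt_e ij; have := ltn_trans ij ji; rewrite ltnn.
rewrite (queues_fromE i) /= eb// mem_head IH//; last first.
  move=> j ij; rewrite eb ?(ltn_trans ki)// in_cons.
  by rewrite -val_eqE/= (gtn_eqF ij).
set X := (X in - (_ * (X * _ * _))).
rewrite big_ord_recl/= -/X [in RHS](bigD1 i) /= ?ki ?leqnn// exprS mulN1r.
have -> : \prod_(j < n.+2 | (k < j < i)%N) factor lam mu (mu k) j y =
  \prod_(j < n.+2 | (k < j <= i)%N && (j != i)) factor lam mu (mu k) j y.
  apply: eq_bigl => j.
  by rewrite -andbA [(j < i)%N]ltn_neqAle [(j <= i)%N && _]andbC.
ring.
Qed.

Lemma prod_runs k e (f : 'I_n.+2 -> R) : path (fun i j => i < j)%N k e ->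
  \prod_(j : 'I_n.+2 | (k < j)%N) f j =
  \prod_(p < size e)
    \prod_(j : 'I_n.+2 | (nth ord0 (k :: e) p < j <= nth ord0 (k :: e) p.+1)%N) f j *
  \prod_(j : 'I_n.+2 | (last k e < j)%N) f j.
Proof.
elim: e k => [|i e IH] k /= pe; first by rewrite big_ord0 mul1r.
have /andP[ki pie] := pe.
rewrite big_ord_recl/= -mulrA -IH// (bigID (fun j : 'I_n.+2 => j <= i)%N)/=.
congr (_ * _); apply: eq_bigl => j; rewrite -ltnNge.
by rewrite andb_idl// => /(ltn_trans ki).
Qed.

Lemma alpha_star_low b (l : 'I_n.+2) : (l <= elt b 0)%N -> alpha_star lam mu b l = 1.
Proof. by move=> h; rewrite /alpha_star h. Qed.

Lemma alpha_star_mid b (p : nat) (l : 'I_n.+2) : (p < #|b|.-1)%N ->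
  (elt b p < l <= elt b p.+1)%N -> alpha_star lam mu b l = rho lam mu (elt b p).
Proof.
move=> pb /andP[pl lp]; have b0 : (0 < #|b|)%N by case: #|b| pb.
have lt_card q : (q <= #|b|.-1)%N -> (q < #|b|)%N by rewrite -ltnS prednK.
rewrite /alpha_star leqNgt (leq_ltn_trans (elt_le _) pl) ?lt_card ?(ltnW pb)//=.
rewrite ltnNge (leq_trans lp) ?elt_le ?lt_card ?pb//=.
case: pickP => [q /andP[ql lq]|/(_ (Ordinal pb))]; last by rewrite /= pl lp.
have -> // : q = p :> nat.
apply/eqP; rewrite eqn_leq; apply/andP; split; rewrite leqNgt; apply/negP => pq.
  have h : (elt b p.+1 <= elt b q)%N by rewrite elt_le// pq lt_card// ltnW.
  by have := leq_ltn_trans (leq_trans lp h) ql; rewrite ltnn.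
have h : (elt b q.+1 <= elt b p)%N by rewrite elt_le// pq lt_card// ltnW.
by have := leq_ltn_trans (leq_trans lq h) pl; rewrite ltnn.
Qed.

Lemma alpha_star_high b (l : 'I_n.+2) : b != finset.set0 -> (max_elt b < l)%N ->
  alpha_star lam mu b l = rho lam mu (max_elt b).
Proof.
rewrite -card_gt0 /alpha_star => b0 bl.
by rewrite leqNgt (leq_ltn_trans (elt_le _) bl) ?prednK//= bl.
Qed.

Hypothesis lam_gt0 : 0 < lam.
Hypothesis stable : forall j, lam < mu j.

Lemma escape_term_set0 y : escape_term finset.set0 lam (queues_from 0) y = 1.
Proof.
rewrite (@escape_term_skip _ _ 0 n.+2) ?leqnn//; last by move=> i _; rewrite inE.
rewrite big1 => [|j _]; last exact: factor_lam.
by rewrite (queues_from_nil (leqnn _)) /= mul1r divff ?exp1rz// lt0r_neq0.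
Qed.

(** Up to the first element of b the parameter is lam and the factors are 1,
    which is the value 1 of alpha_star there.  On each later interval, a factor
    splits into a ratio of rates, which belongs to c_star or to the leading
    product, and a power of alpha_star, which belongs to the bracket. *)
Lemma escape_term_closed b y : b != finset.set0 ->
  - escape_term b lam (queues_from 0) y =
  \prod_(l < n.+2 | (max_elt b < l)%N) ((mu l - lam) / (mu l - mu (max_elt b))) *
  (c_star lam mu b * bracket (rho lam mu (max_elt b)) (alpha_star lam mu b) y).
Proof.
move=> b0; case Eb: (enum b) => [|k e].
  by move: b0; rewrite -card_gt0 cardE Eb.
have pe : path (fun i j => i < j)%N k e by have := enum_sorted b; rewrite Eb.
have ltT : transitive (fun i j : 'I_n.+2 => i < j)%N.
  by move=> ? ? ?; apply: ltn_trans.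
have ek j : j \in e -> (k < j)%N by move=> /(allP (order_path_min ltT pe)).
have bE j : (j \in b) = (j == k) || (j \in e) by rewrite -mem_enum Eb.
have eltE p : elt b p = nth ord0 (k :: e) p by rewrite /elt Eb.
have card_b : #|b|.-1 = size e by rewrite cardE Eb.
have maxE : max_elt b = last k e.
  by rewrite /max_elt eltE card_b -[size e]/((size (k :: e)).-1) nth_last.
rewrite (@escape_term_skip _ _ 0 k) ?(ltnW (ltn_ord k))//; last first.
  move=> j jk; rewrite bE -val_eqE/= (ltn_eqF jk)/=.
  by apply/negP => /ek kj; have := ltn_trans kj jk; rewrite ltnn.
rewrite big1 => [|j _]; last exact: factor_lam.
rewrite (queues_fromE k) /= bE eqxx factor_lam// !mul1r opprK.
rewrite (escape_term_runs y pe) => [|i ki]; last by rewrite bE -val_eqE/= gtn_eqF.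
have -> : bracket (rho lam mu (max_elt b)) (alpha_star lam mu b) y =
  rho lam mu (max_elt b) ^ gap y *
  \prod_(j : 'I_n.+2 | (k < j)%N) alpha_star lam mu b j ^ y 0 j.
  congr (_ * _); rewrite (bigID (fun j : 'I_n.+2 => k < j)%N)/=.
  rewrite [X in _ * X]big1 ?mulr1 => [|j /andP[_ jk]]; last first.
    by rewrite alpha_star_low ?exp1rz// eltE leqNgt.
  apply: eq_bigl => j; case: ltnP; rewrite ?andbF// andbT -val_eqE/= => kj.
  by rewrite -lt0n (leq_ltn_trans _ kj).
rewrite (prod_runs _ pe) /c_star card_b -maxE.
have -> : \prod_(p < size e)
    \prod_(j : 'I_n.+2 | (nth ord0 (k :: e) p < j <= nth ord0 (k :: e) p.+1)%N)
      factor lam mu (mu (nth ord0 (k :: e) p)) j y =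
  \prod_(p < size e) \prod_(j : 'I_n.+2 | (elt b p < j <= elt b p.+1)%N)
      ((mu j - lam) / (mu j - mu (elt b p))) *
  \prod_(p < size e)
    \prod_(j : 'I_n.+2 | (nth ord0 (k :: e) p < j <= nth ord0 (k :: e) p.+1)%N)
      alpha_star lam mu b j ^ y 0 j.
  rewrite -big_split; apply: eq_bigr => p _; rewrite -!eltE -big_split.
  apply: eq_bigr => j pj; rewrite /= (@alpha_star_mid b p)//.
  by rewrite card_b.
have -> : \prod_(j : 'I_n.+2 | (max_elt b < j)%N)
      factor lam mu (mu (max_elt b)) j y =
  \prod_(j < n.+2 | (max_elt b < j)%N) ((mu j - lam) / (mu j - mu (max_elt b))) *
  \prod_(j < n.+2 | (max_elt b < j)%N) alpha_star lam mu b j ^ y 0 j.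
  rewrite -big_split; apply: eq_bigr => j bj /=.
  by rewrite alpha_star_high.
rewrite -/(rho lam mu (max_elt b)); ring.
Qed.

Lemma sum_h_star y :
  \sum_(k < n.+2)
     (\prod_(l < n.+2 | (k < l)%N) ((mu l - lam) / (mu l - mu k))) *
     h_star lam mu k y = 1 - no_hit lam mu y.
Proof.
rewrite /no_hit escape_expand (bigD1 finset.set0) ?finset.sub0set//=.
rewrite escape_term_set0 opprD addrA subrr add0r -sumrN.
rewrite [RHS](eq_bigl (fun b : {set 'I_n.+2} => b != finset.set0)); last first.
  move=> b; rewrite andb_idl// => _; apply/fintype.subsetP => i _.
  by rewrite inE mem_queues_from.
rewrite sum_by_max_elt; apply: eq_bigr => k _; rewrite mulr_sumr.
apply: eq_bigr => a ak; rewrite escape_term_closed ?max_elt_setU1//.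
by apply/set0Pn; exists k; apply: finset.setU11.
Qed.
End Expansion.

(** * The hitting probability *)

Theorem proposition6p5 (R : realType) (n : nat) (lam : R) (mu : 'I_n.+2 -> R)
    (lam_gt0 : 0 < lam) (mu_gt0 : forall j : 'I_n.+2, 0 < mu j)
    (sum_rates : lam + \sum_(j < n.+2) mu j = 1)
    (stable : forall j : 'I_n.+2, lam < mu j)
    (mu_distinct : forall i j : 'I_n.+2, i != j -> mu i != mu j)
    (d : measure_display) (T : measurableType d) (P : probability T R)
    (I : nat -> T -> 'rV[int]_n.+2)
    (I_iid : iid_increments P lam mu I)
    (y : 'rV[int]_n.+2) (yB : B y) :
  P [set w | (tau R (chain I y) w < +oo)%E] =
  (\sum_(k < n.+2)
     (\prod_(l < n.+2 | (k < l)%N) ((mu l - lam) / (mu l - mu k))) *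
     h_star lam mu k y)%:E.
Proof.
rewrite (sum_h_star lam_gt0 stable).
apply: (probability_tau I_iid sum_rates).
exact: (cvg_hit_prob_no_hit lam_gt0 sum_rates stable mu_distinct).
Qed.
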